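(* The algorithm V_Polynomial (described in the context) solves the visibility polynomial problem: given a graph $G=(V,E)$, it outputs the vector of coefficients of the visibility polynomial of $G$, and it runs in $O\bigl(|V|\,(|V|+|E|)\,2^{|V|}\bigr)$ time.
   Context: Graphs are finite, simple and undirected. For a graph $G=(V,E)$ and $X\subseteq V$, two vertices $u,v$ are $X$-visible if there is a shortest $(u,v)$-path $P$ in $G$ with $V(P)\cap X\subseteq\{u,v\}$. A set $X\subseteq V$ is a mutual-visibility set of $G$ if every pair of vertices in $X$ is $X$-visible (the empty set counts as a mutual-visibility set). The visibility polynomial of $G$ is $\mathcal{V}(G)=\sum_{i\ge 0} r_i x^i$, where $r_i$ is the number of mutual-visibility sets of $G$ of cardinality $i$. Visibility polynomial problem: given a graph $G$ of order $n$, find its visibility polynomial. Known subroutine (Di Stefano): there is an algorithm MV which, given $G=(V,E)$ and $P\subseteq V$, decides whether $P$ is a mutual-visibility set of $G$ in $O(|P|(|V|+|E|))$ time. Algorithm V_Polynomial: on input $G=(V,E)$ with $n=|V|$, initialize $\mathrm{Counts}[0\ldots n]=[1,0,\ldots,0]$; for $k=1,\ldots,n$ and for each subset $P\subseteq V$ with $|P|=k$, if MV$(G,P)$ returns True, increment $\mathrm{Counts}[k]$ by $1$; finally return $\mathrm{Counts}$. *)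

(* Defs.v *)
(* Mathematical Components world. *)
From mathcomp Require Import all_boot all_order all_algebra.
From mathcomp Require Import boolp.
From Stdlib Require Import String.

Set Implicit Arguments.
Unset Strict Implicit.
Unset Printing Implicit Defensive.

Record sgraph := SGraph {
  vertex :> finType;
  adj : rel vertex;
  adj_sym : symmetric adj;
  adj_irrefl : irreflexive adj
}.

Definition edges (G : sgraph) : {set {set G}} :=
  [set [set e.1; e.2] | e : G * G & adj e.1 e.2].

Section Visibility.
Variable G : sgraph.

(* The path with vertex sequence u :: p; its length is size p. *)
Definition is_path (u v : G) (p : seq G) : Prop :=
  [/\ path (@adj G) u p, last u p = v & uniq (u :: p)].

Definition is_shortest_path (u v : G) (p : seq G) : Prop :=
  is_path u v p /\ forall q : seq G, is_path u v q -> size p <= size q.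

Definition visible (X : {set G}) (u v : G) : Prop :=
  exists2 p : seq G, is_shortest_path u v p &
    forall w : G, w \in u :: p -> w \in X -> w = u \/ w = v.

Definition mutual_visibility_set (X : {set G}) : Prop :=
  forall u v : G, u \in X -> v \in X -> visible X u v.

Definition num_visibility_sets (i : nat) : nat :=
  #|[set X : {set G} | `[< mutual_visibility_set X >] & #|X| == i]|.

(* No set of vertices has more than #|G| elements, so the sum of the
   num_visibility_sets i * 'X^i over all i >= 0 stops at i = #|G|. *)
Definition visibility_polynomial : {poly nat} :=
  (\poly_(i < #|G|.+1) num_visibility_sets i)%R.

End Visibility.

(* A subroutine that takes a graph and a set of its vertices and returns a
   truth value, given by its answers and its running times. *)
Record subroutine := Subroutine {
  answer : forall G : sgraph, {set G} -> bool;
  run_time : forall G : sgraph, {set G} -> nat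
}.

(* A random access machine under the uniform cost criterion: natural-number
   registers and arrays; every literal, register read, array read, addition,
   comparison, assignment, branch and subroutine call costs one time unit, and
   a subroutine call costs in addition the running time of the subroutine. *)
Inductive expr :=
| Lit of nat
| Reg of string
| Get of string & expr
| Add of expr & expr.

Inductive test :=
| Eq of expr & expr
| Le of expr & expr.

Inductive com :=
| Skip
| Assign of string & expr
| Put of string & expr & expr
| Seq of com & com
| If of test & com & com
| While of test & com
| Call of string & string & expr.

Record store := Store {
  reg : string -> nat;
  arr : string -> nat -> nat
}.

Definition set_reg (s : store) (x : string) (m : nat) : store :=
  Store (fun y => if String.eqb y x then m else reg s y) (arr s).

Definition set_arr (s : store) (a : string) (i m : nat) : store :=
  Store (reg s)
    (fun b j => if String.eqb b a && (j == i) then m else arr s b j).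

Fixpoint eval (s : store) (e : expr) : nat :=
  match e with
  | Lit m => m
  | Reg x => reg s x
  | Get a e1 => arr s a (eval s e1)
  | Add e1 e2 => eval s e1 + eval s e2
  end.

Fixpoint expr_cost (e : expr) : nat :=
  match e with
  | Lit _ | Reg _ => 1
  | Get _ e1 => (expr_cost e1).+1
  | Add e1 e2 => (expr_cost e1 + expr_cost e2).+1
  end.

Definition holds (s : store) (b : test) : bool :=
  match b with
  | Eq e1 e2 => eval s e1 == eval s e2
  | Le e1 e2 => eval s e1 <= eval s e2
  end.

Definition test_cost (b : test) : nat :=
  match b with Eq e1 e2 | Le e1 e2 => (expr_cost e1 + expr_cost e2).+1 end.

(* The machine knows the vertices by their numbers 0, ..., #|G|.-1, the number
   of v being enum_rank v. *)
Definition vertices_of (G : sgraph) (c : nat -> nat) (m : nat) : {set G} :=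
  [set v : G | nat_of_ord (enum_rank v) \in [seq c i | i <- iota 0 m]].

Section Execution.
Variables (M : subroutine) (G : sgraph).

(* exec p s s' t: started in s, the program p halts in s' after t time units.
   Call x a e runs M on G and on the set of vertices whose numbers are the
   first e entries of the array a, and puts the answer (0 or 1) in x. *)
Inductive exec : com -> store -> store -> nat -> Prop :=
| ExecSkip s : exec Skip s s 1
| ExecAssign s x e :
    exec (Assign x e) s (set_reg s x (eval s e)) (expr_cost e).+1
| ExecPut s a e1 e2 :
    exec (Put a e1 e2) s (set_arr s a (eval s e1) (eval s e2))
      (expr_cost e1 + expr_cost e2).+1
| ExecSeq p q s s1 s2 t1 t2 :
    exec p s s1 t1 -> exec q s1 s2 t2 -> exec (Seq p q) s s2 (t1 + t2)
| ExecIf b p q s s1 t :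
    exec (if holds s b then p else q) s s1 t ->
    exec (If b p q) s s1 (test_cost b + t).+1
| ExecWhileStop b p s :
    ~~ holds s b -> exec (While b p) s s (test_cost b).+1
| ExecWhileStep b p s s1 s2 t1 t2 :
    holds s b -> exec p s s1 t1 -> exec (While b p) s1 s2 t2 ->
    exec (While b p) s s2 (test_cost b + t1 + t2).+1
| ExecCall s x a e :
    let P := vertices_of G (arr s a) (eval s e) in
    exec (Call x a e) s (set_reg s x (answer M P))
      (expr_cost e + run_time M P).+1.

Definition halts_with (p : com) (s : store) (Q : store -> nat -> Prop) : Prop :=
  (exists s' t, exec p s s' t) /\ (forall s' t, exec p s s' t -> Q s' t).

End Execution.

Declare Scope com_scope.
Delimit Scope com_scope with com.
Notation "p ;; q" := (Seq p q) (at level 90, right associativity) : com_scope.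

Definition For (x : string) (lo hi : expr) (p : com) : com :=
  (Assign x lo ;;
   While (Le (Reg x) hi) (p ;; Assign x (Add (Reg x) (Lit 1))))%com.

Local Open Scope string_scope.
Local Open Scope com_scope.

(* Knuth's Algorithm L: with c[0] < ... < c[k-1] the current k-subset of
   {0, ..., n-1} and the sentinels c[k] = n, c[k+1] = 0, move to the next one
   in colexicographic order, or clear the register more if there is none. *)
Definition next_subset : com :=
  Assign "j" (Lit 0) ;;
  While (Eq (Add (Get "c" (Reg "j")) (Lit 1))
            (Get "c" (Add (Reg "j") (Lit 1))))
    (Put "c" (Reg "j") (Reg "j") ;;
     Assign "j" (Add (Reg "j") (Lit 1))) ;;
  If (Eq (Reg "j") (Reg "k"))
    (Assign "more" (Lit 0))
    (Put "c" (Reg "j") (Add (Get "c" (Reg "j")) (Lit 1))).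

Definition first_subset : com :=
  For "j" (Lit 0) (Reg "k") (Put "c" (Reg "j") (Reg "j")) ;;
  Put "c" (Reg "k") (Reg "n") ;;
  Put "c" (Add (Reg "k") (Lit 1)) (Lit 0) ;;
  Assign "more" (Lit 1).

Definition V_Polynomial : com :=
  Put "Counts" (Lit 0) (Lit 1) ;;
  For "k" (Lit 1) (Reg "n") (Put "Counts" (Reg "k") (Lit 0)) ;;
  For "k" (Lit 1) (Reg "n")
    (first_subset ;;
     While (Eq (Reg "more") (Lit 1))
       (Call "r" "c" (Reg "k") ;;
        If (Eq (Reg "r") (Lit 1))
          (Put "Counts" (Reg "k") (Add (Get "Counts" (Reg "k")) (Lit 1)))
          Skip ;;
        next_subset)).

(* The order of the graph is in the register n; everything else in the memory
   is arbitrary. The adjacency of the graph is consulted by the subroutine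
   only. *)
Definition input_store (G : sgraph) (s : store) : Prop := reg s "n" = #|G|.

Definition output (G : sgraph) (s : store) : seq nat :=
  mkseq (arr s "Counts") #|G|.+1.

Definition coefficient_vector (G : sgraph) : seq nat :=
  mkseq (fun i => (visibility_polynomial G)`_i)%R #|G|.+1.

(* Main.v *)
Require Import Defs.
From Stdlib Require Import String.
From mathcomp Require Import all_boot all_order all_algebra.
From mathcomp Require Import boolp zify.

(** Everything rests on the claim that, in the round for [k], Algorithm L visits
every [k]-subset of the vertices exactly once. The witness is the combinatorial
number system: a [k]-subset with elements [c_0 < ... < c_(k-1)] gets the rank
[\sum_(i < k) 'C(c_i, i.+1)]. The first subset, [0, ..., k-1], has rank 0, and
the step from one subset to the next adds 1 to the rank in the way in which 1
is added to a number in positional notation: while the loop of [next_subset]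
resets the entries of a block of consecutive numbers, position [j] is owed the
carry ['C(c_j, j)], and Pascal's rule says both that resetting [c_j] to [j]
passes the carry ['C(c_(j+1), j+1)] on to position [j+1], and that replacing
[c_j] by [c_j + 1] absorbs it ([runs_next_subset]). If the carry reaches the
sentinel [c_k = n], all entries below contribute 0 and the carry is
['C(n, k)], so the number of visited subsets is ['C(n, k)]. The visited subsets
have the distinct ranks 0, 1, ..., ['C(n, k) - 1], so they are distinct, and as
there are ['C(n, k)] of them they are all the [k]-subsets
([count_all_combinations]). Hence the round leaves in [Counts[k]] the number of
[k]-subsets accepted by the subroutine, which is the coefficient of [x^k].

For the time, write [n] and [m] for the numbers of vertices and of edges and
[D] for [n * (n + m)]. A visit costs [O(D)] for the subroutine and [O(k)] for
the move to the next subset, and the rest of a round costs [O(k)]. As [k <= D],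
a round costs [O(D * (1 + 'C(n, k)))], and the sum over [k] is [O(D * 2 ^ n)].

Programs are treated with a total-correctness predicate [runs] that bounds
results and time at once; since execution is deterministic, it says everything
about all executions of the program. *)

Set Implicit Arguments.
Unset Strict Implicit.
Unset Printing Implicit Defensive.

Local Open Scope string_scope.
Local Open Scope com_scope.

(** * A logic for total correctness and running time *)

Section ProgramLogic.
Variables (M : subroutine) (G : sgraph).

Definition runs (p : com) (s : store) (Q : store -> nat -> Prop) : Prop :=
  exists s' t, exec M G p s s' t /\ Q s' t.

Lemma exec_deterministic p s s1 t1 s2 t2 :
  exec M G p s s1 t1 -> exec M G p s s2 t2 -> s1 = s2 /\ t1 = t2.
Proof.
move=> E1; elim: E1 s2 t2 => {p s s1 t1}.
- by move=> s s2 t2 E; inversion E.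
- by move=> s x e s2 t2 E; inversion E.
- by move=> s a e1 e2 s2 t2 E; inversion E.
- move=> p q s s1 s1' t1 t1' _ IHp _ IHq s2 t2 E; inversion E; subst.
  match goal with Ep : exec M G p _ _ _ |- _ => have [? ?] := IHp _ _ Ep end.
  subst.
  match goal with Eq : exec M G q _ _ _ |- _ => have [? ?] := IHq _ _ Eq end.
  by subst.
- move=> b p q s s1 t _ IH s2 t2 E; inversion E; subst.
  match goal with Eb : exec M G _ _ _ _ |- _ => have [? ?] := IH _ _ Eb end.
  by subst.
- move=> b p s /negP hb s2 t2 E; inversion E; subst => //.
- move=> b p s s1 s1' t1 t1' hb _ IHp _ IHw s2 t2 E; inversion E; subst.
    match goal with Nb : is_true (~~ holds _ _) |- _ => by rewrite hb in Nb end.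
  match goal with Ep : exec M G p _ _ _ |- _ => have [? ?] := IHp _ _ Ep end.
  subst.
  match goal with Ew : exec M G (While _ _) _ _ _ |- _ =>
    have [? ?] := IHw _ _ Ew end.
  by subst.
- by move=> s x a e P s2 t2 E; inversion E.
Qed.

Lemma runs_halts_with p s Q : runs p s Q -> halts_with M G p s Q.
Proof.
move=> [s' [t [E HQ]]]; split; first by exists s', t.
by move=> s1 t1 /(exec_deterministic E) [<- <-].
Qed.

Lemma runs_mono p s (Q Q' : store -> nat -> Prop) :
  runs p s Q -> (forall s' t, Q s' t -> Q' s' t) -> runs p s Q'.
Proof. by move=> [s' [t [E HQ]]] QQ'; exists s', t; split; last exact: QQ'. Qed.

Lemma runs_skip s (Q : store -> nat -> Prop) : Q s 1 -> runs Skip s Q.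
Proof. by exists s, 1; split; first exact: ExecSkip. Qed.

Lemma runs_assign s x e (Q : store -> nat -> Prop) :
  Q (set_reg s x (eval s e)) (expr_cost e).+1 -> runs (Assign x e) s Q.
Proof. by move=> HQ; do 2 eexists; split; first exact: ExecAssign. Qed.

Lemma runs_put s a e1 e2 (Q : store -> nat -> Prop) :
  Q (set_arr s a (eval s e1) (eval s e2)) (expr_cost e1 + expr_cost e2).+1 ->
  runs (Put a e1 e2) s Q.
Proof. by move=> HQ; do 2 eexists; split; first exact: ExecPut. Qed.

Lemma runs_call s x a e (Q : store -> nat -> Prop) :
  let P := vertices_of G (arr s a) (eval s e) in
  Q (set_reg s x (answer M P)) (expr_cost e + run_time M P).+1 ->
  runs (Call x a e) s Q.
Proof. by move=> P HQ; do 2 eexists; split; first exact: ExecCall. Qed.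

Lemma runs_seq p q s (Q : store -> nat -> Prop) :
  runs p s (fun s1 t1 => runs q s1 (fun s2 t2 => Q s2 (t1 + t2))) ->
  runs (p ;; q) s Q.
Proof.
move=> [s1 [t1 [E1 [s2 [t2 [E2 HQ]]]]]].
by exists s2, (t1 + t2); split=> //; apply: ExecSeq E1 E2.
Qed.

Lemma runs_if b p q s (Q : store -> nat -> Prop) :
  runs (if holds s b then p else q) s (fun s1 t => Q s1 (test_cost b + t).+1) ->
  runs (If b p q) s Q.
Proof.
move=> [s1 [t [E HQ]]].
by exists s1, (test_cost b + t).+1; split=> //; apply: ExecIf.
Qed.

(** The index of the invariant counts iterations, so that one bound [N] on it
yields both termination and the running time. The bound [T] depends on the
index because the rounds of the main loop differ in cost. *)
Lemma runs_while (I : nat -> store -> Prop) N T b p s r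
    (Q : store -> nat -> Prop) :
  I r s ->
  (forall i s1, I i s1 -> holds s1 b ->
     i < N /\ runs p s1 (fun s2 t => t <= T i /\ I i.+1 s2)) ->
  (forall i s1 t, I i s1 -> ~~ holds s1 b ->
     t <= \sum_(r <= j < N) (T j + (test_cost b).+1) + (test_cost b).+1 ->
     Q s1 t) ->
  runs (While b p) s Q.
Proof.
move=> + step; move: {2}(N - r) (leqnn (N - r)) => d.
elim: d r s Q => [|d IHd] r s Q le_d Ir fin.
- have [hb|hb] := boolP (holds s b).
    by have [lt_rN _] := step _ _ Ir hb; lia.
  exists s, (test_cost b).+1; split; first exact: ExecWhileStop.
  by apply: fin Ir hb _; rewrite leq_addl.
have [hb|hb] := boolP (holds s b); last first.
  exists s, (test_cost b).+1; split; first exact: ExecWhileStop.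
  by apply: fin Ir hb _; rewrite leq_addl.
have [lt_rN [s1 [t1 [E1 [le_t1 I1]]]]] := step _ _ Ir hb.
suff [s2 [t2 [E2 HQ]]] : runs (While b p) s1
    (fun s2 t2 => Q s2 (test_cost b + t1 + t2).+1).
  by exists s2, (test_cost b + t1 + t2).+1; split=> //; apply: ExecWhileStep E2.
apply: IHd I1 _ => [|i s2 t2 I2 hb2 le_t2]; first by lia.
apply: fin I2 hb2 _; rewrite big_ltn //.
by move: (\sum_(_ <= j < N) _) le_t2 => S; lia.
Qed.

(** The index of the invariant is the value of the loop variable; [I i.+1] is
asked of the store after the increment. The bounds on [a] and [b] allow empty
ranges, which occur for the graph without vertices. *)
Lemma runs_for (I : nat -> store -> Prop) T x lo hi a b p s
    (Q : store -> nat -> Prop) :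
  eval s lo = a -> a <= b.+1 ->
  (forall i s1, I i s1 -> reg s1 x = i /\ eval s1 hi = b) ->
  I a (set_reg s x a) ->
  (forall i s1, a <= i <= b -> I i s1 ->
     runs p s1 (fun s2 t => [/\ t <= T i, reg s2 x = i &
                               I i.+1 (set_reg s2 x i.+1)])) ->
  (forall s1 t, I b.+1 s1 ->
     t <= expr_cost lo + \sum_(a <= i < b.+1) (T i + expr_cost hi + 7)
            + expr_cost hi + 4 -> Q s1 t) ->
  runs (For x lo hi p) s Q.
Proof.
move=> Ea le_ab Ireg Ia step fin.
apply: runs_seq; apply: runs_assign; rewrite Ea.
apply: (@runs_while (fun i s1 => [/\ a <= i, i <= b.+1 & I i s1]) b.+1
          (fun i => T i + 4) _ _ _ a); first by split.
- move=> i s1 [le_ai le_ib Ii] /=; have [-> ->] := Ireg _ _ Ii => lt_ib.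
  split=> //; apply: runs_seq.
  apply: runs_mono (step i s1 _ Ii) _; first by rewrite le_ai.
  move=> s2 t [le_t Ei Ii1]; apply: runs_assign.
  split; first by rewrite leq_add.
  by rewrite /= Ei addn1; split=> //; rewrite ltnW.
- move=> i s1 t [le_ai le_ib Ii] /=; have [-> ->] := Ireg _ _ Ii => lt_bi.
  have Ei : i = b.+1 by lia.
  rewrite Ei in Ii.
  rewrite (eq_bigr (fun i => T i + expr_cost hi + 7)); last by move=> ? _; lia.
  move=> le_t; apply: fin Ii _.
  by move: (\sum_(_ <= _ < _) _) le_t => S; lia.
Qed.

End ProgramLogic.

(** * Ranks in the combinatorial number system *)

Definition combination (n k : nat) : pred (seq nat) :=
  [pred s | [&& size s == k, sorted ltn s & all (ltn^~ n) s]].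

(** The position of [s] in the colexicographic order of the combinations of its
size. *)
Definition rank (s : seq nat) : nat := \sum_(i < size s) 'C(nth 0 s i, i.+1).

Definition increasing (c : nat -> nat) (k : nat) : Prop :=
  forall i, i < k -> c i < c i.+1.

Lemma combination_mkseq c k : increasing c k -> combination (c k) k (mkseq c k).
Proof.
move=> inc; rewrite /combination /= size_mkseq eqxx /=.
rewrite (sorted_pairwise ltn_trans) andbC -pairwise_rcons -mkseqS.
rewrite -(sorted_pairwise ltn_trans); apply/(sortedP 0) => i.
by rewrite size_mkseq => lt_ik; rewrite !nth_mkseq ?(ltnW lt_ik) //; apply: inc.
Qed.

Lemma rank_mkseq c k : rank (mkseq c k) = \sum_(i < k) 'C(c i, i.+1).
Proof.
by rewrite /rank size_mkseq; apply: eq_bigr => i _; rewrite nth_mkseq.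
Qed.

Lemma rank_mkseq_id c k : (forall i, i < k -> c i = i) -> rank (mkseq c k) = 0.
Proof.
by move=> cE; rewrite rank_mkseq big1 // => i _; rewrite cE // bin_small.
Qed.

Lemma rank_update c k j m : j < k ->
  rank (mkseq (fun i => if i == j then m else c i) k) + 'C(c j, j.+1)
    = rank (mkseq c k) + 'C(m, j.+1).
Proof.
move=> lt_jk; rewrite !rank_mkseq !(bigD1 (Ordinal lt_jk) isT) /= eqxx.
rewrite [X in _ + X + _ = _](eq_bigr (fun i : 'I_k => 'C(c i, i.+1))).
  by lia.
by move=> i; rewrite -val_eqE /= => /negbTE ->.
Qed.

(** By induction on [k]: the entries below [c k] have rank less than
['C(c k, k)], so adding the entry [c k] keeps the rank below
['C(c k, k) + 'C(c k, k.+1) = 'C((c k).+1, k.+1)], and [c k < c k.+1]. With the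
sentinel as last entry this bounds the ranks of all combinations. *)
Lemma rank_lt c k : increasing c k -> rank (mkseq c k) < 'C(c k, k).
Proof.
rewrite rank_mkseq; elim: k => [|k IHk] inc; first by rewrite big_ord0 bin0.
rewrite big_ord_recr /=.
apply: (@leq_trans 'C((c k).+1, k.+1)); last exact/leq_bin2l/inc.
rewrite binS addnC ltn_add2l; apply: IHk => i lt_ik; exact/inc/ltnW.
Qed.

(** * From sequences of numbers to sets of vertices *)

Section NumberedVertices.
Variable G : sgraph.

Definition numbered (s : seq nat) : {set G} :=
  [set v | nat_of_ord (enum_rank v) \in s].

(** Gives both the cardinality of a numbered set and, since a strictly sorted
sequence is determined by its elements, the injectivity of [numbered]. *)
Lemma numbers_numbered s : uniq s -> all (ltn^~ #|G|) s ->
  perm_eq [seq nat_of_ord (enum_rank v) | v <- enum (numbered s)] s.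
Proof.
move=> uniq_s /allP lt_s; apply: uniq_perm => //.
  rewrite map_inj_uniq ?enum_uniq // => u v /val_inj; exact: enum_rank_inj.
move=> i; apply/mapP/idP => [[v]|s_i]; first by rewrite mem_enum inE => ? ->.
exists (enum_val (Ordinal (lt_s i s_i))); last by rewrite enum_valK.
by rewrite mem_enum inE enum_valK.
Qed.

Lemma card_numbered k s : combination #|G| k s -> #|numbered s| = k.
Proof.
case/and3P=> /eqP <- /(sorted_uniq ltn_trans ltnn) uniq_s lt_s.
by rewrite cardE -(perm_size (numbers_numbered uniq_s lt_s)) size_map.
Qed.

Lemma numbered_inj k :
  {in combination #|G| k &, injective numbered}.
Proof.
move=> s s' /and3P[_ sort_s lt_s] /and3P[_ sort_s' lt_s'] eq_ss'.
apply: (irr_sorted_eq ltn_trans ltnn) => //.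
have us := sorted_uniq ltn_trans ltnn sort_s.
have us' := sorted_uniq ltn_trans ltnn sort_s'.
apply: perm_mem; apply: perm_trans (numbers_numbered us' lt_s').
by rewrite -eq_ss' perm_sym numbers_numbered.
Qed.

(** Distinct ranks make the sequences distinct, and as many distinct [k]-subsets
as there are [k]-subsets must be all of them. *)
Lemma count_all_combinations k (a : pred {set G}) (ss : seq (seq nat)) :
  all (combination #|G| k) ss -> [seq rank s | s <- ss] = iota 0 'C(#|G|, k) ->
  count (a \o numbered) ss = #|[set X | a X & #|X| == k]|.
Proof.
move=> /allP comb_ss rank_ss.
have uniq_ss : uniq ss.
  by apply: (@map_uniq _ _ rank); rewrite rank_ss iota_uniq.
have size_ss : size ss = 'C(#|G|, k).
  by rewrite -(size_map rank) rank_ss size_iota.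
have uniq_X : uniq (map numbered ss).
  rewrite map_inj_in_uniq // => s s' /comb_ss ? /comb_ss.
  exact: numbered_inj.
have sub_X : {subset map numbered ss <= enum [set X : {set G} | #|X| == k]}.
  move=> _ /mapP[s /comb_ss s_comb ->].
  by rewrite mem_enum inE (card_numbered s_comb).
have [|_ eq_X] := uniq_min_size uniq_X sub_X.
  by rewrite -cardE card_draws size_map size_ss.
rewrite -count_map -size_filter cardE; apply: perm_size.
apply: uniq_perm; [exact/filter_uniq | exact: enum_uniq | move=> X].
by rewrite mem_filter eq_X !mem_enum !inE.
Qed.

End NumberedVertices.

(** * The algorithm *)

Section Algorithm.
Variables (M : subroutine) (G : sgraph).

(** The sentinel [c k = n] makes the single condition [increasing] also say that
the entries are below [n]; [c k.+1 = 0] stops the carry at position [k]. *)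
Definition loaded (n k : nat) (c : nat -> nat) : Prop :=
  [/\ increasing c k, c k = n & c k.+1 = 0].

Definition unchanged (s s' : store) : Prop :=
  [/\ reg s' "n" = reg s "n", reg s' "k" = reg s "k"
    & arr s' "Counts" = arr s "Counts"].

(** Addition of 1 with carry: the loop keeps the rank plus the owed carry
['C(c j, j)] equal to [r.+1]. *)
Lemma runs_next_subset n k r s :
  reg s "k" = k -> loaded n k (arr s "c") ->
  rank (mkseq (arr s "c") k) = r ->
  runs M G next_subset s (fun s' t =>
    [/\ t <= 17 * k + 22, unchanged s s' &
      [/\ reg s' "more" = reg s "more", loaded n k (arr s' "c")
         & rank (mkseq (arr s' "c") k) = r.+1]
      \/ reg s' "more" = 0 /\ 'C(n, k) = r.+1]).
Proof.
move=> Ek [inc ck ck1] rk.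
pose I j s1 := [/\ reg s1 "j" = j /\ j <= k, unchanged s s1,
  reg s1 "more" = reg s "more" /\ (forall i, i < j -> arr s1 "c" i = i),
  loaded n k (arr s1 "c")
  & rank (mkseq (arr s1 "c") k) + 'C(arr s1 "c" j, j) = r.+1].
have I_c j s1 : I j s1 -> j <= arr s1 "c" j.
  case: j => [//|j] [[_ lt_jk] _ [_ low] [inc1 _ _] _].
  by rewrite -{1}(low j) // inc1.
apply: runs_seq; apply: runs_assign; apply: runs_seq.
apply: (@runs_while _ _ I k (fun=> 7) _ _ _ 0).
- (* The carry into position 0 is 'C(c 0, 0) = 1. *)
  by split=> //=; rewrite rk bin0 addn1.
- move=> j s1 Ij; have ge_j := I_c _ _ Ij.
  case: Ij => [[Ej le_jk] [un uk uC] [um low] [inc1 ck1' ck1''] carry].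
  rewrite /= Ej !addn1 => /eqP run.
  have lt_jk : j < k.
    rewrite ltn_neqAle le_jk andbT; apply/eqP => jk.
    by rewrite jk ck1'' in run.
  split=> //; apply: runs_seq; apply: runs_put; apply: runs_assign.
  split; first by [].
  split=> /=; rewrite ?Ej ?addn1; first by split.
  + by split.
  + split=> // i; rewrite ltnS leq_eqVlt.
    by case: eqP => [-> //|_ /= lt_ij]; rewrite low.
  + split=> /=; last by case: eqP => // ?; lia.
      move=> i lt_ik; have := inc1 i lt_ik.
      case: (eqVneq i j) => [->|ne_ij]; case: eqP => //=; try lia.
      by move=> eq_ij; rewrite low; lia.
    by case: eqP => // ?; lia.
  have := rank_update (arr s1 "c") j lt_jk; rewrite (bin_small (ltnSn j)) addn0.
  have -> : (j.+1 == j) = false by apply/eqP; lia.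
  (* The reset costs 'C(c j, j.+1); the carry becomes
     'C((c j).+1, j.+1) = 'C(c j, j.+1) + 'C(c j, j). *)
  by move: carry; rewrite -run binS; lia.
move=> j s1 t Ij; have ge_j := I_c _ _ Ij.
case: Ij => [[Ej le_jk] [un uk uC] [um low] [inc1 ck1' ck1''] carry].
rewrite /= Ej !addn1 => /eqP stop; rewrite sum_nat_const_nat => le_t.
apply: runs_if; rewrite /= uk Ek Ej; case: eqP => [jk|/eqP ne_jk].
  apply: runs_assign; split=> /=; first by lia.
    by [].
  right; split=> //; move: carry.
  by rewrite jk ck1' rank_mkseq_id // => i; rewrite -jk; apply: low.
have lt_jk : j < k by rewrite ltn_neqAle ne_jk.
apply: runs_put; split=> /=; first by lia.
  by [].
left; rewrite Ej addn1; split=> //.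
  split=> /=; try by case: eqP => // ?; lia.
  move=> i lt_ik; have := inc1 i lt_ik; case: (eqVneq i j) => [->|ne_ij].
    have -> : (j.+1 == j) = false by apply/eqP; lia.
    by have := inc1 j lt_jk; lia.
  by case: eqP => [->|] //; lia.
have := rank_update (arr s1 "c") ((arr s1 "c" j).+1) lt_jk.
by rewrite binS; lia.
Qed.

Lemma runs_first_subset n k s : reg s "n" = n -> reg s "k" = k -> k <= n ->
  runs M G first_subset s (fun s' t =>
    [/\ t <= 11 * k + 27, unchanged s s', reg s' "more" = 1,
        loaded n k (arr s' "c") & rank (mkseq (arr s' "c") k) = 0]).
Proof.
move=> En Ek le_kn; apply: runs_seq.
apply: (@runs_for _ _ (fun j s1 => [/\ reg s1 "j" = j, unchanged s s1
          & forall i, i < j -> arr s1 "c" i = i])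
          (fun=> 3) _ _ _ 0 k) => //.
- by move=> j s1 [Ej [_ uk _] _]; split=> //=; rewrite uk.
- move=> j s1 _ [Ej [un uk uC] low]; apply: runs_put; split=> //.
  split=> //= i; rewrite Ej ltnS leq_eqVlt.
  by case: eqP => [-> //|_ /= lt_ij]; rewrite low.
move=> s1 t [_ [un uk uC] low]; rewrite sum_nat_const_nat /= => le_t.
apply: runs_seq; apply: runs_put; apply: runs_seq; apply: runs_put.
apply: runs_assign; rewrite /= ?uk ?un ?Ek ?En.
have cE i : i < k -> (if i == k + 1 then 0 else if i == k then n
    else arr s1 "c" i) = i.
  move=> lt_ik; case: eqP => [?|_]; first by lia.
  by case: eqP => [?|_]; [lia | apply: low; lia].
split=> //=; first by lia.
  split=> /=; [|by rewrite eqxx; case: eqP => // ?; lia|by rewrite addn1 eqxx].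
  move=> i lt_ik /=; rewrite cE //.
  case: eqP => [?|_]; first by lia.
  case: eqP => [?|_]; first by lia.
  by rewrite low; lia.
exact: rank_mkseq_id.
Qed.

Definition V_Polynomial_round : com :=
  first_subset ;;
  While (Eq (Reg "more") (Lit 1))
    (Call "r" "c" (Reg "k") ;;
     If (Eq (Reg "r") (Lit 1))
       (Put "Counts" (Reg "k") (Add (Get "Counts" (Reg "k")) (Lit 1)))
       Skip ;;
     next_subset).

(** The sequences [ss] visited so far have the ranks 0, ..., [r.-1], and the
current one has rank [r]; so [r] counts the iterations, is less than
['C(#|G|, k)] by [rank_lt] as long as there is a current combination, and
equals ['C(#|G|, k)] at the end. *)
Lemma runs_round W k s :
  (forall P : {set G}, P != set0 -> run_time M P <= W) ->
  reg s "n" = #|G| -> reg s "k" = k -> 0 < k <= #|G| ->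
  arr s "Counts" k = 0 ->
  runs M G V_Polynomial_round s (fun s' t =>
    [/\ t <= 11 * k + 31 + 'C(#|G|, k) * (W + 17 * k + 38),
        reg s' "n" = #|G|, reg s' "k" = k,
        arr s' "Counts" k = #|[set X : {set G} | answer M X & #|X| == k]|
      & forall i, i != k -> arr s' "Counts" i = arr s "Counts" i]).
Proof.
move=> leW En Ek /andP[k_gt0 le_kn] C0; apply: runs_seq.
apply: runs_mono (runs_first_subset En Ek le_kn) _.
move=> s0 t0 [le_t0 [un uk uC] more0 load0 rank0].
pose I r s1 := exists2 ss,
  all (combination #|G| k) ss /\ [seq rank u | u <- ss] = iota 0 r &
  [/\ reg s1 "n" = #|G|, reg s1 "k" = k,
     arr s1 "Counts" k = count (@answer M G \o numbered G) ss,
     forall i, i != k -> arr s1 "Counts" i = arr s "Counts" i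
   & [/\ reg s1 "more" = 1, loaded #|G| k (arr s1 "c")
        & rank (mkseq (arr s1 "c") k) = r]
     \/ reg s1 "more" = 0 /\ 'C(#|G|, k) = r].
apply: (@runs_while _ _ I 'C(#|G|, k) (fun=> W + 17 * k + 34) _ _ _ 0).
- exists [::] => //; split; rewrite ?un ?uk ?uC ?C0 //; by left.
- move=> r s1 [ss [comb_ss rank_ss] [En1 Ek1 C1 Cs1 cur]] /= /eqP more1.
  case: cur => [[_ load1 rank1]|[]]; last by rewrite more1.
  have [inc1 ck1 ck1'] := load1.
  have comb1 := combination_mkseq inc1; rewrite ck1 in comb1.
  split; first by rewrite -rank1 -ck1 rank_lt.
  apply: runs_seq; apply: runs_call; apply: runs_seq; rewrite /= Ek1.
  set P := vertices_of _ _ _.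
  have PE : P = numbered G (mkseq (arr s1 "c") k) by [].
  have le_timeP : run_time M P <= W.
    by apply: leW; rewrite -card_gt0 PE (card_numbered comb1).
  pose s2 := set_reg s1 "r" (answer M P).
  suff : runs M G (If (Eq (Reg "r") (Lit 1))
      (Put "Counts" (Reg "k") (Add (Get "Counts" (Reg "k")) (Lit 1))) Skip) s2
    (fun s3 t3 => [/\ t3 <= 10, reg s3 "n" = #|G|, reg s3 "k" = k,
       arr s3 "Counts" k = answer M P + count (@answer M G \o numbered G) ss &
       [/\ forall i, i != k -> arr s3 "Counts" i = arr s "Counts" i,
           arr s3 "c" = arr s1 "c" & reg s3 "more" = 1]]).
    move=> runs_count; apply: runs_mono runs_count _.
    move=> s3 t3 [le_t3 En3 Ek3 C3 [Cs3 c3 more3]].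
    rewrite -c3 in load1 rank1.
    apply: runs_mono (runs_next_subset Ek3 load1 rank1) _.
    move=> s4 t4 [le_t4 [un4 uk4 uC4] next4]; split; first by lia.
    exists (rcons ss (mkseq (arr s1 "c") k)).
      rewrite all_rcons comb1 comb_ss map_rcons rank_ss -c3 rank1.
      by rewrite -addn1 iotaD cats1.
    split; rewrite ?un4 ?uk4 ?uC4 //; last by rewrite more3 in next4.
    by rewrite C3 -cats1 count_cat /= addn0 addnC.
  apply: runs_if; rewrite /=; case: (answer M P) => /=.
    apply: runs_put; split; rewrite //= Ek1 ?eqxx; first by rewrite addn1 C1.
    by split=> // i /negbTE ne_ik; rewrite ne_ik Cs1 // ne_ik.
  by apply: runs_skip; split.
move=> r s1 t [ss [comb_ss rank_ss] [En1 Ek1 C1 Cs1 cur]] /= more1.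
rewrite sum_nat_const_nat => le_t.
case: cur => [[m1 _ _]|[_ Er]]; first by rewrite m1 in more1.
split=> //; first by rewrite subn0 in le_t; nia.
by rewrite C1 (count_all_combinations _ comb_ss) // rank_ss Er.
Qed.

Lemma num_visibility_sets_answer k :
  (forall P : {set G}, answer M P <-> mutual_visibility_set P) ->
  num_visibility_sets G k = #|[set X : {set G} | answer M X & #|X| == k]|.
Proof.
move=> MV_correct; apply: eq_card => X; rewrite !inE.
by congr (_ && _); apply/asboolP/idP => /MV_correct.
Qed.

Lemma runs_V_Polynomial W s :
  (forall P : {set G}, answer M P <-> mutual_visibility_set P) ->
  (forall P : {set G}, P != set0 -> run_time M P <= W) ->
  input_store G s ->
  runs M G V_Polynomial s (fun s' t => output G s' = coefficient_vector G /\
    t <= 11 * #|G| + 15 + \sum_(1 <= k < #|G|.+1)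
           (11 * k + 39 + 'C(#|G|, k) * (W + 17 * k + 38))).
Proof.
move=> MV_correct leW En; apply: runs_seq; apply: runs_put; apply: runs_seq.
apply: (@runs_for _ _ (fun k s1 => [/\ reg s1 "n" = #|G|, reg s1 "k" = k,
          arr s1 "Counts" 0 = 1
        & forall i, 0 < i < k -> arr s1 "Counts" i = 0])
        (fun=> 3) _ _ _ 1 #|G|) => //.
- by move=> k s1 [].
- by split=> //= i; case: i.
- move=> k s1 /andP[k_gt0 le_kn] [En1 Ek1 C0 Cs]; apply: runs_put; split=> //.
  split=> //=; rewrite Ek1; first by case: eqP => // ?; lia.
  by move=> i ik; case: eqP => // ne_ik; apply: Cs; lia.
move=> s1 t1 [En1 _ C0 Cs]; rewrite sum_nat_const_nat /= => le_t1.
pose num k := #|[set X : {set G} | answer M X & #|X| == k]|.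
apply: (@runs_for _ _ (fun k s2 => [/\ reg s2 "n" = #|G|, reg s2 "k" = k,
          forall i, i < k -> arr s2 "Counts" i = num i
        & forall i, k <= i <= #|G| -> arr s2 "Counts" i = 0])
        (fun k => 11 * k + 31 + 'C(#|G|, k) * (W + 17 * k + 38))
        _ _ _ 1 #|G|) => //.
- by move=> k s2 [].
- split=> //=.
  move=> [|//] _; rewrite C0 /num (_ : [set X | _] = [set set0]) ?cards1 //.
  apply/setP => X; rewrite !inE cards_eq0.
  case: eqP => [->|_]; rewrite ?andbF // andbT.
  by apply/MV_correct => u v; rewrite inE.
- move=> k s2 le_k [En2 Ek2 filled todo].
  apply: runs_mono (runs_round leW En2 Ek2 le_k _) _.
    by apply: todo; lia.
  move=> s3 t3 [le_t3 En3 Ek3 C3 Cs3]; split=> //; split=> //= i.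
    rewrite ltnS leq_eqVlt; case: (eqVneq i k) => [-> //|ne_ik /= lt_ik].
    by rewrite Cs3 // filled.
  case/andP=> lt_ki le_in.
  by rewrite Cs3 ?(gtn_eqF lt_ki) // todo ?(ltnW lt_ki).
move=> s2 t2 [_ _ filled _] le_t2; split.
  apply/eq_in_map => i; rewrite mem_iota add0n => /andP[_ lt_in].
  by rewrite coef_poly lt_in num_visibility_sets_answer ?filled.
rewrite (eq_bigr (fun k => 11 * k + 39 + 'C(#|G|, k) * (W + 17 * k + 38)))
  /= in le_t2; last by move=> k _ /=; lia.
by move: (\sum_(_ <= _ < _) _) le_t2 => S; lia.
Qed.

End Algorithm.

(** Here [D] stands for [n * (n + m)], with [m] the number of edges. Each
summand is at most [(c + 55) * D * (1 + 'C(n, k))], since [k] and 1 are at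
most [D]; these sum up to at most [2 * (c + 55) * D * 2 ^ n], as [n <= 2 ^ n],
and the remaining [11 * n + 15] is at most [26 * D]. *)
Lemma V_Polynomial_time_bound c n D : 0 < n <= D ->
  11 * n + 15 + \sum_(1 <= k < n.+1)
      (11 * k + 39 + 'C(n, k) * (c * D + 17 * k + 38))
    <= (2 * c + 136) * (D * 2 ^ n).
Proof.
move=> /andP[n_gt0 le_nD].
have sum_bin : \sum_(1 <= k < n.+1) 'C(n, k) <= 2 ^ n.
  rewrite -[2]/(1 + 1) expnDn [leqRHS]big_ord_recl.
  rewrite big_add1 big_mkord; apply: leq_trans (leq_addl _ _).
  by apply: leq_sum => i _; rewrite !exp1n !muln1.
have lt_n2 : n < 2 ^ n := ltn_expl n (ltnSn 1).
have le_sum : \sum_(1 <= k < n.+1)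
      (11 * k + 39 + 'C(n, k) * (c * D + 17 * k + 38))
    <= (c + 55) * D * \sum_(1 <= k < n.+1) (1 + 'C(n, k)).
  rewrite big_distrr /= big_nat_cond [leqRHS]big_nat_cond.
  apply: leq_sum => k; rewrite andbT => /andP[k_gt0 lt_kn].
  by move: 'C(n, k) => b; nia.
apply: (leq_trans (leq_add (leqnn _) le_sum)).
rewrite big_split /= sum_nat_const_nat subn1 muln1 /=.
by move: (\sum_(_ <= _ < _) _) (2 ^ n) sum_bin lt_n2 => S E; nia.
Qed.

Theorem theorem25 (MV : subroutine)
  (MV_correct : forall (G : sgraph) (P : {set G}),
     answer MV P <-> mutual_visibility_set P)
  (MV_time : exists c : nat, forall (G : sgraph) (P : {set G}), P != set0 ->
     run_time MV P <= c * (#|P| * (#|G| + #|edges G|))) :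
  (forall (G : sgraph) (s : store), input_store G s ->
     halts_with MV G V_Polynomial s
       (fun s' _ => output G s' = coefficient_vector G)) /\
  (exists C : nat, forall (G : sgraph) (s : store), input_store G s ->
     0 < #|G| ->
     halts_with MV G V_Polynomial s
       (fun _ t => t <= C * (#|G| * (#|G| + #|edges G|) * 2 ^ #|G|))).
Proof.
have [c MV_time_c] := MV_time.
have leW (G : sgraph) (P : {set G}) : P != set0 ->
    run_time MV P <= c * (#|G| * (#|G| + #|edges G|)).
  move=> /MV_time_c /leq_trans; apply.
  by rewrite leq_mul2l leq_mul2r max_card !orbT.
have run G s (Hs : input_store G s) :=
  runs_V_Polynomial (MV_correct G) (@leW G) Hs.
split=> [G s Hs|]; last exists (2 * c + 136) => G s Hs G_gt0.
  by apply: runs_halts_with; apply: runs_mono (run G s Hs) _ => s' t [].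
apply: runs_halts_with; apply: runs_mono (run G s Hs) _ => s' t [_ /leq_trans].
by apply; apply: V_Polynomial_time_bound; rewrite G_gt0; nia.
Qed.
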